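(* Suppose that $(\mathcal A,\mathcal T,(-),\preceq)$ is a $(-)$-bipotent cancellative semiring system, with the $\circ$-pre-order $\le_\circ$. Then any $\mathcal A$-matroid over $E$, represented by a Grassmann–Plücker map $b:E^m\to\mathcal A$, satisfies: for $e_0,\dots,e_m,f_2,\dots,f_m\in E$ with $$b(e_1,\dots,e_m)\,b(e_0,f_2,\dots,f_m)\in\mathcal T,$$ there exists some $i$, $1\le i\le m$, with $$b(e_1,\dots,e_m)\,b(e_0,f_2,\dots,f_m)\ \le_\circ\ b(e_0,\dots,\hat e_i,\dots,e_m)\,b(e_i,f_2,\dots,f_m),$$ where $\hat e_i$ means that $e_i$ is omitted.
   Context: **Systems.** Let $(\mathcal A,+,0)$ be a commutative additive monoid with a subset $\mathcal T\subset\mathcal A$, $0\notin\mathcal T$, $\mathcal T_0=\mathcal T\cup\{0\}$. $\mathcal A$ is a $\mathcal T$-gen bimodule if $\mathcal T_0$ is a multiplicative monoid with unit $1\in\mathcal T$, additively generates $\mathcal A$, and acts on $\mathcal A$ on the left with $(a_1a_2)b=a_1(a_2b)$, $0b=0$, $1b=b$, $a1=a$, $a0=0$, $a\sum b_i=\sum ab_i$ ($a,a_i\in\mathcal T_0$, $b,b_i\in\mathcal A$), and likewise on the right. It is cancellative if $ab_1=ab_2$ implies $b_1=b_2$ and $b_1a=b_2a$ implies $b_1=b_2$ for $a\in\mathcal T$. A negation map is an additive isomorphism $(-):\mathcal A\to\mathcal A$ of order $\le2$ with $(-)1\in\mathcal T$ and $((-)a)b=(-)(ab)=a((-)b)$ for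 $a\in\mathcal T,b\in\mathcal A$ (similarly on the right). Write $b(-)c=b+((-)c)$, $b^\circ=b(-)b$, $\mathcal A^\circ=\{b^\circ\}$. A triple is a $\mathcal T$-gen bimodule with a negation map such that $\mathcal A^\circ\cap\mathcal T=\emptyset$. It is $(-)$-bipotent if $a+a'\in\{a,a'\}$ whenever $a,a'\in\mathcal T$ with $a'\ne(-)a$. A surpassing relation $\preceq$ is a reflexive transitive relation with: $b\preceq0\Rightarrow b=0$; $0\preceq b^\circ$; $b_i\preceq b_i'$ ($i=1,2$) implies $a_1b_1+a_2b_2\preceq a_1b_1'+a_2b_2'$ and $b_1a_1+b_2a_2\preceq b_1'a_1+b_2'a_2$ for $a_i\in\mathcal T$, and $b_1b_2\preceq b_1'b_2'$ when $\mathcal A$ carries a multiplication; $a\preceq a'$ with $a,a'\in\mathcal T_0$ implies $a=a'$. Put $\mathcal A_{\rm Null}=\{b:0\preceq b\}$. A system is a triple with a surpassing relation such that $a,a'\in\mathcal T$ and $a(-)a'\in\mathcal A_{\rm Null}$ imply $a=a'$; a semiring system is one in which $\mathcal A$ is a (doubly distributive) semiring whose multiplication restricts to the $\mathcal T_0$-actions. **The pre-order $\le_\circ$.** The relation $b\preceq_\circ b'$ means $b+c=b'$ for some $c\in\mathcal A^\circ$. It is known that in a cancellative $(-)$-bipotent triple each $b\in\mathcal A$ has a uniform presentation: there are $m\in\mathbb N$, taken minimal (then $m$ is the height of $b$, the least number of elements of $\mathcal T$ summing to $b$), and $b_{\mathcal T}\in\mathcal T_0$ with $b=mb_{\mathcal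 T}=b_{\mathcal T}+\dots+b_{\mathcal T}$ if $m\ne2$, and $b=b_{\mathcal T}^\circ$ if $m=2$; $b_{\mathcal T}$ is unique if $m\neq2$ and $b_{\mathcal T}^\circ$ is in all cases determined by $b$. Define $b_1\le_\circ b_2$ if $(b_1)_{\mathcal T}^\circ\preceq_\circ(b_2)_{\mathcal T}^\circ$. **Matroids.** $(-)^kb$ is $b$ for even $k$ and $(-)b$ for odd $k$; $(-)^{\mathrm{sgn}(\pi)}b$ is $b$ for even $\pi$, $(-)b$ for odd $\pi$. A Grassmann–Plücker map of degree $m$ with ground set $E$ is a map $b:E^m\to\mathcal A$ such that: (i) some $b(e_1,\dots,e_m)\in\mathcal T$; (ii) $b(e_1,\dots,e_m)\in\mathcal A_{\rm Null}$ whenever $e_i=e_j$ for some $i\ne j$; (iii) $b(e_{\pi(1)},\dots,e_{\pi(m)})=(-)^{\mathrm{sgn}(\pi)}b(e_1,\dots,e_m)$ for $\pi\in S_m$; (iv) for any $e_0,\dots,e_m,e_2',\dots,e_m'\in E$, $\sum_{i=0}^m(-)^ib(e_0,\dots,e_{i-1},e_{i+1},\dots,e_m)\,b(e_i,e_2',\dots,e_m')\in\mathcal A_{\rm Null}$. An $\mathcal A$-matroid is an equivalence class of such maps, where $b_1,b_2$ are equivalent if $a_1b_1=a_2b_2$ for some $a_1,a_2\in\mathcal T$. *)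

(* Defs.v *)
From HB Require Import structures.
From mathcomp Require Import all_boot all_algebra all_fingroup.
From mathcomp Require Import boolp classical_sets.

Set Implicit Arguments.
Unset Strict Implicit.
Unset Printing Implicit Defensive.

Import GRing.Theory.

Local Open Scope classical_set_scope.
Local Open Scope ring_scope.

Section Systems.
Variable A : pzSemiRingType.
Implicit Types (T S : set A) (neg : A -> A) (prec : A -> A -> Prop).

Definition zero_ext T : set A := T `|` [set 0].

Definition sum_of S (k : nat) (b : A) : Prop :=
  exists s : 'I_k -> A, (forall i, S (s i)) /\ b = \sum_(i < k) s i.

(* The actions of T_0 on A are restrictions of the multiplication of A, so the
   remaining bimodule axioms (associativity, units, zeros, distributivity) are
   the semiring axioms of A. *)
Record Tgen_bimodule T : Prop := TgenBimodule {
  Tgen_zero : ~ T 0;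
  Tgen_one : T 1;
  Tgen_mul : forall a1 a2,
    zero_ext T a1 -> zero_ext T a2 -> zero_ext T (a1 * a2);
  Tgen_gen : forall b, exists k, sum_of (zero_ext T) k b }.

Definition cancellative T : Prop :=
  (forall a b1 b2, T a -> a * b1 = a * b2 -> b1 = b2) /\
  (forall a b1 b2, T a -> b1 * a = b2 * a -> b1 = b2).

Record negation_map T neg : Prop := NegationMap {
  neg_zero : neg 0 = 0;
  neg_add : {morph neg : b c / b + c};
  neg_invol : involutive neg;
  neg_one : T (neg 1);
  neg_mull : forall a b, T a -> neg a * b = neg (a * b) /\ neg (a * b) = a * neg b;
  neg_mulr : forall a b, T a -> b * neg a = neg (b * a) /\ neg (b * a) = neg b * a }.

Definition circ neg (b : A) : A := b + neg b.

Definition circ_set neg : set A := range (circ neg).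

Record triple T neg : Prop := Triple {
  triple_bimodule : Tgen_bimodule T;
  triple_neg : negation_map T neg;
  triple_disjoint : circ_set neg `&` T = set0 }.

Definition bipotent T neg : Prop :=
  forall a a', T a -> T a' -> a' <> neg a -> a + a' = a \/ a + a' = a'.

Record surpassing T neg prec : Prop := Surpassing {
  prec_refl : forall b, prec b b;
  prec_trans : forall b c d, prec b c -> prec c d -> prec b d;
  prec_zero : forall b, prec b 0 -> b = 0;
  prec_circ0 : forall b, prec 0 (circ neg b);
  prec_addl : forall a1 a2 b1 b2 b1' b2', T a1 -> T a2 ->
    prec b1 b1' -> prec b2 b2' ->
    prec (a1 * b1 + a2 * b2) (a1 * b1' + a2 * b2');
  prec_addr : forall a1 a2 b1 b2 b1' b2', T a1 -> T a2 ->
    prec b1 b1' -> prec b2 b2' ->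
    prec (b1 * a1 + b2 * a2) (b1' * a1 + b2' * a2);
  prec_mul : forall b1 b2 b1' b2',
    prec b1 b1' -> prec b2 b2' -> prec (b1 * b2) (b1' * b2');
  prec_T0 : forall a a', zero_ext T a -> zero_ext T a' -> prec a a' -> a = a' }.

Definition null_set prec : set A := [set b | prec 0 b].

Record semiring_system T neg prec : Prop := SemiringSystem {
  system_triple : triple T neg;
  system_surpassing : surpassing T neg prec;
  system_unique_neg : forall a a', T a -> T a' ->
    null_set prec (a + neg a') -> a = a' }.

Definition prec_circ neg (b b' : A) : Prop :=
  exists2 c, circ_set neg c & b + c = b'.

Definition is_height T (b : A) (k : nat) : Prop :=
  sum_of T k b /\ forall j, sum_of T j b -> (k <= j)%N.

(* [t] is an admissible choice of b_T.  The height of 0 is 0 (empty sum), for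
   which [b = t *+ 0] does not constrain [t]; the convention is 0_T = 0. *)
Definition uniform_part T neg (b t : A) : Prop :=
  zero_ext T t /\
  exists k, [/\ is_height T b k,
                k = 0%N -> t = 0 &
                b = if k == 2%N then circ neg t else t *+ k].

Definition le_circ T neg (b1 b2 : A) : Prop :=
  exists t1 t2, [/\ uniform_part T neg b1 t1,
                    uniform_part T neg b2 t2 &
                    prec_circ neg (circ neg t1) (circ neg t2)].

Definition signed neg (odd_sign : bool) (b : A) : A :=
  if odd_sign then neg b else b.

End Systems.

Definition omit (E : Type) (n : nat) (e : n.+1.-tuple E) (i : 'I_n.+1) :
  n.-tuple E := [tuple tnth e (lift i k) | k < n].

Section Matroids.
Variables (A : pzSemiRingType) (E : Type).
Implicit Types (T : set A) (neg : A -> A) (prec : A -> A -> Prop).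

(* The degree m is at least 1 (the vectors (e_2', ..., e_m') have m - 1
   entries), and is written n.+1. *)
Record Grassmann_Plucker T neg prec (n : nat) (b : n.+1.-tuple E -> A) : Prop :=
  GrassmannPlucker {
  GP_nontrivial : exists e, T (b e);
  GP_repeat : forall (e : n.+1.-tuple E) (i j : 'I_n.+1),
    i != j -> tnth e i = tnth e j -> null_set prec (b e);
  GP_alternating : forall (e : n.+1.-tuple E) (p : 'S_n.+1),
    b [tuple tnth e (p k) | k < n.+1] = signed neg (odd_perm p) (b e);
  GP_relation : forall (e : n.+2.-tuple E) (e' : n.-tuple E),
    null_set prec
      (\sum_(i < n.+2)
         signed neg (odd i) (b (omit e i) * b (cons_tuple (tnth e i) e'))) }.

Definition GP_equiv T (n : nat) (b1 b2 : n.+1.-tuple E -> A) : Prop :=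
  exists a1 a2, [/\ T a1, T a2 & forall e, a1 * b1 e = a2 * b2 e].

Definition is_matroid T neg prec (n : nat) (M : set (n.+1.-tuple E -> A)) :
    Prop :=
  exists2 b0, Grassmann_Plucker T neg prec b0 &
    M = [set b | Grassmann_Plucker T neg prec b /\ GP_equiv T b0 b].

End Matroids.

(* Main.v *)
Require Import Defs.
From mathcomp Require Import all_boot all_algebra.
From mathcomp Require Import boolp classical_sets.

(** In a [(-)]-bipotent triple two tangible elements either are negatives of
    each other, or one of them absorbs the other in the sum.  Two facts follow.

    Uniform presentations ([uniform_part_exists]): a sum of tangibles of minimal
    length admits no pair of summands with tangible sum, since that pair could
    be merged.  Hence any two summands are negatives of each other, and from
    three summands on this forces all of them to be equal.

    Absorption ([absorbs_uniform]): if [a] is tangible and [a <=o x] fails, then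
    [a] dominates the uniform part of [x] strictly, hence absorbs both [x] and
    [neg x].

    Now let [a] be the tangible product of index 0 in the Grassmann-Plucker
    relation.  If [a <=o x] failed for every other product [x], the whole
    alternating sum would collapse to [a], so that [0] would be below the
    tangible [a] in the surpassing relation.  Tangibles being incomparable with
    [0], this is absurd. *)

Set Implicit Arguments.
Unset Strict Implicit.
Unset Printing Implicit Defensive.

Import GRing.Theory.

Local Open Scope ring_scope.

(** * Sums of elements of a given set *)

Section SumOf.
Variable A : pzSemiRingType.
Implicit Types (S T : set A).

Lemma sum_of_cons S k x y : S x -> sum_of S k y -> sum_of S k.+1 (x + y).
Proof.
move=> Sx [s [Ss ->]].
exists (fun i => if unlift ord0 i is Some j then s j else x); split.
  by move=> i; case: (unlift ord0 i).
rewrite big_ord_recl unlift_none; congr (_ + _).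
by apply: eq_bigr => i _; rewrite liftK.
Qed.

Lemma sum_of_subset S (I : finType) (P : {pred I}) (s : I -> A) :
  (forall i, i \in P -> S (s i)) -> sum_of S #|P| (\sum_(i in P) s i).
Proof.
move=> SP; exists (fun k => s (enum_val k)); split.
  by move=> k; apply: SP; apply: enum_valP.
exact: big_enum_val.
Qed.

Lemma sum_of_drop0 T k b :
  sum_of (zero_ext T) k b -> exists j, sum_of T j b.
Proof.
move=> [s [Ts ->]]; exists #|[pred i | s i != 0]|.
rewrite (bigID [pred i | s i != 0]) /= [X in _ + X]big1 ?addr0; last first.
  by move=> i; rewrite negbK => /eqP.
apply: (@sum_of_subset T _ [pred i | s i != 0]) => i; rewrite inE => /eqP si0.
by case: (Ts i).
Qed.

Lemma sum_of_merge T k (s : 'I_k.+2 -> A) (i j : 'I_k.+2) :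
  (forall l, T (s l)) -> i != j -> T (s i + s j) ->
  sum_of T k.+1 (\sum_l s l).
Proof.
move=> Ts ij Tij.
rewrite (bigD1 i) //= (bigD1 j) 1?eq_sym //= addrA.
apply: sum_of_cons => //.
set P : {pred 'I_k.+2} := [pred l | (l != i) && (l != j)].
have Pk : #|P| = k.
  apply: (@addnI 2%N).
  rewrite -[RHS](card_ord k.+2) [RHS](cardD1 i) (cardD1 j [predD1 'I_k.+2 & i]).
  rewrite !inE eq_sym ij addnA; congr (_ + _)%N.
  by apply: eq_card => l; rewrite !inE andbT andbC.
have : sum_of T #|P| (\sum_(l in P) s l) by apply: sum_of_subset.
by rewrite Pk.
Qed.

Lemma sum_of_height T k b : sum_of T k b -> exists h, is_height T b h.
Proof.
move=> bk; have ex : exists h, `[< sum_of T h b >].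
  by exists k; apply/asboolP.
case: (ex_minnP ex) => h /asboolP bh hmin.
by exists h; split=> // j bj; apply: hmin; apply/asboolP.
Qed.

End SumOf.

(** * Uniform presentations and absorption in bipotent triples *)

Section BipotentTriple.
Variables (A : pzSemiRingType) (T : set A) (neg : A -> A).
Hypothesis HT : triple T neg.
Hypothesis Hbip : bipotent T neg.

Let Hneg : negation_map T neg := triple_neg HT.
Let negK : involutive neg := neg_invol Hneg.
Let T0 : ~ T 0 := Tgen_zero (triple_bimodule HT).

Lemma circD x y : circ neg (x + y) = circ neg x + circ neg y.
Proof. by rewrite /circ (neg_add Hneg) addrACA. Qed.

Lemma circN x : circ neg (neg x) = circ neg x.
Proof. by rewrite /circ negK addrC. Qed.

Lemma prec_circ_refl x : prec_circ neg x x.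
Proof.
by exists 0; rewrite ?addr0 //; exists 0; rewrite // /circ (neg_zero Hneg) addr0.
Qed.

Lemma tangible_neg a : T a -> T (neg a).
Proof.
move=> Ta; have T1 := Tgen_one (triple_bimodule HT).
have Na : neg a = neg 1 * a by rewrite (neg_mull Hneg a T1).1 mul1r.
have [||//|Na0] := Tgen_mul (triple_bimodule HT) (a1 := neg 1) (a2 := a).
- by left; apply: neg_one Hneg.
- by left.
- by rewrite Na.
by case: T0; rewrite -(neg_zero Hneg) -Na0 -Na negK.
Qed.

Lemma uniform_part_tangible a : T a -> uniform_part T neg a a.
Proof.
move=> Ta; split; first by left.
exists 1%N; split=> //; split.
  by exists (fun=> a); rewrite big_ord1.
move=> [|j] // [s [_ a0]].
by case: T0; rewrite big_ord0 in a0; rewrite -a0.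
Qed.

(** Two summands that are not opposite have a tangible sum by bipotence, and
    merging them would give a shorter sum. *)
Lemma minimal_sum_opposite k (s : 'I_k.+2 -> A) (i j : 'I_k.+2) :
  (forall l, T (s l)) -> is_height T (\sum_l s l) k.+2 -> i != j ->
  s j = neg (s i).
Proof.
move=> Ts [_ smin] ij; apply: contrapT => sjNi.
have Tij : T (s i + s j) by case: (Hbip (Ts i) (Ts j) sjNi) => ->.
by have := smin _ (sum_of_merge Ts ij Tij); rewrite ltnn.
Qed.

(** With at least three summands, pairwise opposite summands are all equal: two
    distinct ones are both opposite to a third. *)
Lemma uniform_part_exists b : exists t, uniform_part T neg b t.
Proof.
have [k0 /sum_of_drop0 [k1 /sum_of_height [k bk]]] :=
  Tgen_gen (triple_bimodule HT) b.
have [[s [Ts Eb]] _] := bk.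
case: k s Ts Eb bk => [|[|[|k]]] s Ts Eb bk.
- exists 0; split; first by right.
  by exists 0%N; split=> //=; rewrite Eb big_ord0.
- by exists b; apply: uniform_part_tangible; rewrite Eb big_ord1.
- exists (s ord0); split; first by left.
  exists 2; split=> //=; rewrite Eb in bk *.
  rewrite big_ord_recl big_ord1 /circ; congr (_ + _).
  exact: minimal_sum_opposite bk _.
- exists (s ord0); split; first by left.
  exists k.+3; split=> //=; rewrite Eb in bk *.
  have opp := minimal_sum_opposite Ts bk.
  have all_eq i : s i = s ord0.
    have [l l0 li] : exists2 l : 'I_k.+3, l != ord0 & l != i.
      have [->|i1] := eqVneq i (inord 1).
        by exists (inord 2); rewrite -val_eqE /= ?inordK.
      by exists (inord 1); [rewrite -val_eqE /= inordK | rewrite eq_sym].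
    by rewrite (opp l i) // (opp l ord0).
  by rewrite (eq_bigr (fun=> s ord0)) // sumr_const card_ord.
Qed.

(** Absorbing [y] together with [neg y] makes the notion insensitive to the
    signs in the Grassmann-Plucker relation. *)
Definition absorbs (a y : A) : Prop := a + y = a /\ a + neg y = a.

Lemma absorbs0 a : absorbs a 0.
Proof. by rewrite /absorbs (neg_zero Hneg) addr0. Qed.

Lemma absorbsD a y z : absorbs a y -> absorbs a z -> absorbs a (y + z).
Proof.
by move=> [ay aNy] [az aNz]; split; rewrite ?(neg_add Hneg) addrA ?ay ?aNy.
Qed.

Lemma absorbsN a y : absorbs a y -> absorbs a (neg y).
Proof. by move=> [ay aNy]; split; rewrite ?negK. Qed.

(** The only other case allowed by bipotence is [a + t = t]; as [circ neg] is
    additive, it gives [circ neg a + circ neg t = circ neg t], which is the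
    excluded comparison. *)
Lemma add_not_prec_circ a t :
  T a -> T t -> ~ prec_circ neg (circ neg a) (circ neg t) -> a + t = a.
Proof.
move=> Ta Tt nle.
have tNa : t <> neg a.
  by move=> tE; apply: nle; rewrite tE circN; apply: prec_circ_refl.
have [//|at_] := Hbip Ta Tt tNa.
case: nle; exists (circ neg t); first by exists t.
by rewrite -circD at_.
Qed.

Lemma absorbs_not_prec_circ a t : T a -> zero_ext T t ->
  ~ prec_circ neg (circ neg a) (circ neg t) -> absorbs a t.
Proof.
move=> Ta [Tt|->] nle; last exact: absorbs0.
by split; apply: add_not_prec_circ; rewrite ?circN //; apply: tangible_neg.
Qed.

Lemma absorbs_uniform a x : T a -> ~ le_circ T neg a x -> absorbs a x.
Proof.
move=> Ta nax; have [t xt] := uniform_part_exists x.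
have [tT0 [k [_ _ ->]]] := xt.
have at_ : absorbs a t.
  apply: absorbs_not_prec_circ => // at_; apply: nax.
  by exists a, t; split=> //; apply: uniform_part_tangible.
case: eqP => _; first by apply: absorbsD => //; apply: absorbsN.
elim: k => [|k IHk]; first exact: absorbs0.
by rewrite mulrS; apply: absorbsD.
Qed.

Lemma absorbs_signed_sum a (I : finType) (s : I -> bool) (x : I -> A) :
  (forall i, absorbs a (x i)) -> a + \sum_i signed neg (s i) (x i) = a.
Proof.
move=> ax; suff [] : absorbs a (\sum_i signed neg (s i) (x i)) by [].
apply: big_ind => [|y z|i _]; [exact: absorbs0 | exact: absorbsD |].
by rewrite /signed; case: (s i) => //; apply: absorbsN.
Qed.

End BipotentTriple.

Lemma tangible_not_null (A : pzSemiRingType) (T : set A) (neg : A -> A)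
    (prec : A -> A -> Prop) (a : A) :
  semiring_system T neg prec -> T a -> ~ null_set prec a.
Proof.
move=> Hsys Ta null_a.
have a0 : 0 = a.
  by apply: (prec_T0 (system_surpassing Hsys)) => //; [right | left].
by apply: (Tgen_zero (triple_bimodule (system_triple Hsys))); rewrite a0.
Qed.

(** * The exchange property *)

Theorem proposition8p10 (A : pzSemiRingType) (T : set A) (neg : A -> A)
    (prec : A -> A -> Prop)
    (Hsys : semiring_system T neg prec)
    (Hbip : bipotent T neg)
    (Hcan : cancellative T)
    (E : Type) (n : nat)
    (M : set (n.+1.-tuple E -> A)) (HM : is_matroid T neg prec M)
    (b : n.+1.-tuple E -> A) (Hb : M b)
    (e : n.+2.-tuple E) (f : n.-tuple E) :
  T (b (omit e ord0) * b (cons_tuple (tnth e ord0) f)) ->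
  exists i : 'I_n.+2, (1 <= i)%N /\
    le_circ T neg
      (b (omit e ord0) * b (cons_tuple (tnth e ord0) f))
      (b (omit e i) * b (cons_tuple (tnth e i) f)).
Proof.
move=> Ta; apply: contrapT => no_i.
have GPb : Grassmann_Plucker T neg prec b.
  by case: HM Hb => b0 _ -> [].
have := GP_relation GPb e f.
rewrite big_ord_recl [signed _ _ _]/=.
rewrite (absorbs_signed_sum (system_triple Hsys)); last first.
  move=> i; apply: (absorbs_uniform (system_triple Hsys) Hbip Ta) => le_i.
  by apply: no_i; exists (lift ord0 i).
exact: tangible_not_null Hsys Ta.
Qed.
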